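(* Let $\alpha\in(0,1)$ and let the temporal mesh $0=t_0<t_1<\dots<t_M=T$ satisfy $\rho_j\ge\rho_{j+1}\ge1$ for all $j\ge2$, where $\rho_j=\tau_j/\tau_{j-1}$ and $\tau_j=t_j-t_{j-1}$. Let $\beta_0=0$ and $\beta_j\in[0,1)$ for $1\le j\le M$, and let $\{\kappa_{m,j}\}$ be the coefficients in the representation $$\delta_t^\alpha U^m=\sum_{j=0}^m \kappa_{m,j}V^j\quad (1\le m\le M),\qquad V^0:=U^0,\qquad V^j:=\frac{U^j-\beta_jU^{j-1}}{1-\beta_j}\quad (1\le j\le M).$$ Let $\{\phi^j\}_{j=0}^M$ be the standard nodal basis, $\phi^j(t_k)=1$ if $k=j$ and $0$ otherwise, and write $\delta_t^\alpha\phi^k(t_m):=D_t^\alpha(\Pi^m\phi^k)(t_m)$. Suppose that $$\delta_t^\alpha\phi^{m-1}(t_m)+\beta_m\,\delta_t^\alpha\phi^m(t_m)<0\qquad\text{for } m\ge1,$$ $$\delta_t^\alpha\phi^{m-2}(t_m)+\beta_{m-1}\bigl[\delta_t^\alpha\phi^{m-1}(t_m)+\beta_m\,\delta_t^\alpha\phi^m(t_m)\bigr]\le0\qquad\text{for } m\ge2$$ (for all such $m\le M$). Then $$\kappa_{m,m}>0\ \text{ and }\ \sum_{j=0}^m\kappa_{m,j}=0\quad\forall\,1\le m\le M,\qquad \kappa_{m,j}\le0\quad\forall\,0\le j<m\le M,$$ and, moreover, $-\kappa_{m,0}\gtrsim t_m^{-\alpha}$ for $m\ge3$.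
   Context: For a continuous, piecewise smooth function $w$, $D_t^\alpha w(t):=\frac1{\Gamma(1-\alpha)}\int_0^t(t-s)^{-\alpha}w'(s)\,ds$ (Caputo derivative). For mesh values $\{U^j\}_{j=0}^M$ (or a mesh function, identified with its vector of nodal values), $\Pi^mU$ is the following continuous piecewise polynomial interpolant on $[0,t_m]$. For $m=1$ it is the linear Lagrange interpolant at $t_0,t_1$. For $m\ge2$, on $(t_{j-1},t_j)$ with $1\le j<m$ it is the quadratic Lagrange interpolant at $t_{j-1},t_j,t_{j+1}$, and on $(t_{m-1},t_m)$ it is the quadratic Lagrange interpolant at $t_{m-2},t_{m-1},t_m$. The discrete fractional-derivative operator is $\delta_t^\alpha U^m:=D_t^\alpha(\Pi^mU)(t_m)$, $1\le m\le M$. The coefficients $\kappa_{m,j}$ are uniquely determined by requiring the representation to hold for all $\{U^j\}$. The mesh condition means $\rho_2\ge\rho_3\ge\dots\ge\rho_M\ge1$. The notation $a\gtrsim b$ means $a\ge Cb$ with a positive constant $C$ that may depend on the fixed $\alpha$ and $T$ but not on $M$, $m$ or the mesh. *)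

(* Defs.v *)
From HB Require Import structures.
From mathcomp Require Import all_boot all_order all_algebra.
From mathcomp Require Import all_classical all_reals all_analysis.

Set Implicit Arguments.
Unset Strict Implicit.
Unset Printing Implicit Defensive.

Import Order.TTheory GRing.Theory Num.Theory.
Import numFieldNormedType.Exports.

Local Open Scope classical_set_scope.
Local Open Scope ring_scope.

Definition Gamma (R : realType) (x : R) : R :=
  \int[lebesgue_measure]_(s in `]0, +oo[) (s `^ (x - 1) * expR (- s)).

(* Meant for continuous, piecewise smooth [w]: the junk values of [w^`()] at
   the finitely many kinks of [w] do not affect the integral. *)
Definition caputo (R : realType) (alpha : R) (w : R -> R) (x : R) : R :=
  (Gamma (1 - alpha))^-1 *
  \int[lebesgue_measure]_(s in `]0, x[) ((x - s) `^ (- alpha) * (w^`()%classic s)).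

(* A mesh t_0 < ... < t_M and a mesh function U^0, ..., U^M are represented by
   sequences; only the terms of index at most M are ever used. *)

Definition tau (R : realType) (t : nat -> R) (j : nat) : R := t j - t j.-1.

Definition rho (R : realType) (t : nat -> R) (j : nat) : R :=
  tau t j / tau t j.-1.

(* Lagrange interpolant of U at the nodes t_i, i in the duplicate-free list J *)
Definition lagrange_interp (R : realType) (t U : nat -> R) (J : seq nat)
    (s : R) : R :=
  \sum_(i <- J) U i * \prod_(k <- J | k != i) ((s - t k) / (t i - t k)).

(* The j with t_(j-1) < s <= t_j, for s in (0, t_m]: the least j in 1..m-1
   with s <= t_j, and m if there is none. *)
Definition cell (R : realType) (t : nat -> R) (m : nat) (s : R) : nat :=
  (find (fun j => s <= t j) (iota 1 m.-1)).+1.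

Definition stencil (m j : nat) : seq nat :=
  if m == 1%N then [:: 0; 1]%N
  else if (j < m)%N then [:: j.-1; j; j.+1]
  else [:: m.-2; m.-1; m].

(* Pi^m U; consecutive pieces agree at the common node, so this is the
   continuous interpolant on [0, t_m]. *)
Definition interpolant (R : realType) (t : nat -> R) (m : nat) (U : nat -> R)
    (s : R) : R :=
  lagrange_interp t U (stencil m (cell t m s)) s.

Definition frac_delta (R : realType) (alpha : R) (t : nat -> R)
    (U : nat -> R) (m : nat) : R :=
  caputo alpha (interpolant t m U) (t m).

Definition nodal_basis (R : realType) (j : nat) : nat -> R :=
  fun k => (k == j)%:R.
Arguments nodal_basis R j k : clear implicits.

Definition Vseq (R : realType) (beta U : nat -> R) (j : nat) : R :=
  if j == 0%N then U 0%N
  else (U j - beta j * U j.-1) / (1 - beta j).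

(* Main.v *)
(* Put c_j = kappa_(m,j) / (1 - beta_j) and a_j = delta phi^j (t_m). Testing the
   representation on the nodal basis gives c_m = a_m and
   c_j = a_j + beta_(j+1) c_(j+1) for j < m. The two assumptions say that
   c_(m-1) < 0 and c_(m-2) <= 0, so descending induction on j gives all signs
   below the diagonal once a_j <= 0 is known for j <= m - 3; the row sum is
   delta 1 = 0, which then forces kappa_(m,m) > 0.

   For j <= m - 3 the interpolant w of phi^j vanishes near t_m. With g the kernel
   (t_m - s)^(-alpha), which is positive, increasing and convex, integration by
   parts turns a_j into a negative multiple of the integral of g' w. As w <= 0 on
   the first cell of its support and w >= 0 on the other two, and as g' is
   increasing, it is enough that w has nonnegative integral over the first two
   cells, which holds because the steps are nondecreasing. The parts formula is
   not used literally: on each cell g w' is bounded by the derivative of a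
   polynomial.

   For j = 0 and m >= 3, w decreases from 1 to 0 on the first cell and vanishes
   afterwards, whence a_0 <= - t_m^(-alpha) / Gamma(1 - alpha). *)

Require Import Defs.
From HB Require Import structures.
From mathcomp Require Import all_boot all_order all_algebra.
From mathcomp Require Import all_classical all_reals all_analysis.
From mathcomp Require Import measurable_realfun zify ring lra.
Import Order.TTheory GRing.Theory Num.Theory.
Import numFieldNormedType.Exports.
Local Open Scope ring_scope.

(** * Upper bounds for integrals over open intervals *)

Lemma integrable_setU (d : measure_display) (T : measurableType d)
    (R : realType) (mu : {measure set T -> \bar R}) (A B : set T) (f : T -> \bar R) :
  measurable A -> measurable B -> [disjoint A & B]%classic ->
  mu.-integrable A f -> mu.-integrable B f -> mu.-integrable (A `|` B)%classic f.
Proof.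
move=> mA mB AB /integrableP[mfA iA] /integrableP[mfB iB].
have mf := proj2 (measurable_funU _ mA mB) (conj mfA mfB).
apply/integrableP; split => //.
rewrite ge0_integral_setU//; first exact: lte_add_pinfty.
exact: measurableT_comp.
Qed.

Section IntegralBounds.
Local Open Scope classical_set_scope.
Local Open Scope ring_scope.
Context {R : realType}.
Implicit Types (a b c u v : R) (g h w : R -> R) (p q : {poly R}).
Notation mu := (@lebesgue_measure R).

(** Integrability is carried along with the bound because additivity over adjacent intervals
    requires it. *)
Definition Rintegral_itv_le h a b u :=
  mu.-integrable `]a, b[ (EFin \o h) /\
  \int[mu]_(s in `]a, b[) h s <= u.

(* The intervals are open, so kinks at the junctions need no attention. *)
Lemma Rintegral_itv_le_split h a b c u v : a <= b -> b <= c ->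
  Rintegral_itv_le h a b u -> Rintegral_itv_le h b c v ->
  Rintegral_itv_le h a c (u + v).
Proof.
rewrite le_eqVlt => /predU1P[<- _ [_ lu] [iv lv]|ab].
  split=> //; apply: le_trans lv _; rewrite lerDr; apply: le_trans lu.
  by rewrite set_itvoo0 Rintegral_set0.
rewrite le_eqVlt => /predU1P[<- [iu lu] [_ lv]|bc].
  split=> //; apply: le_trans lu _; rewrite lerDl; apply: le_trans lv.
  by rewrite set_itvoo0 Rintegral_set0.
move=> [iu lu] [iv lv].
have E : `]a, c[%classic = `]a, b]%classic `|` `]b, c[%classic.
  by rewrite -itv_bndbnd_setU// bnd_simp; exact: ltW.
have E1 : `]a, b]%classic = `]a, b[%classic `|` [set b].
  by rewrite setUitv1// bnd_simp.
have i1 : mu.-integrable [set b] (EFin \o h).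
  apply: null_set_integrable => //; last exact: lebesgue_measure_set1.
  exact: measurable_fun_set1.
have d1 : [disjoint `]a, b[%classic & [set b]]%classic.
  by apply/disj_setPS => y [/= + yb]; rewrite in_itv/= yb ltxx andbF.
have d2 : [disjoint `]a, b]%classic & `]b, c[%classic]%classic.
  apply/disj_setPS => y [/=]; rewrite !in_itv/= => /andP[_ yb] /andP[+ _].
  by rewrite ltNge yb.
have i2 : mu.-integrable `]a, b] (EFin \o h) by rewrite E1; exact: integrable_setU.
have i3 : mu.-integrable `]a, c[ (EFin \o h) by rewrite E; exact: integrable_setU.
split => //; rewrite E Rintegral_setU -?E//= lerD//.
by rewrite E1 Rintegral_setU -?E1//= Rintegral_set1 addr0.
Qed.

(** Continuity of [g] on the closed interval makes [h] integrable; the fundamental theorem of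
    calculus is applied to the polynomial [q] alone. *)
Lemma Rintegral_itv_le_poly h g a b q : a <= b ->
  {within `[a, b]%classic, continuous g} ->
  {in `]a, b[, h =1 g} ->
  {in `]a, b[, forall s, g s <= q^`().[s]} ->
  Rintegral_itv_le h a b (q.[b] - q.[a]).
Proof.
rewrite le_eqVlt => /predU1P[<- _ _ _|ab cg hg gq].
  by rewrite /Rintegral_itv_le set_itvoo0 Rintegral_set0 subrr; split => //;
    exact: integrable_set0.
have sub : (`]a, b[ `<=` `[a, b])%classic by exact: subset_itv_oo_cc.
have ig : mu.-integrable `]a, b[ (EFin \o g).
  apply: (@integrableS _ _ _ mu `[a, b]%classic) => //.
  exact/continuous_compact_integrable/cg/segment_compact.
have cq : {within `[a, b]%classic, continuous (horner q^`())}.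
  by apply: continuous_subspaceT; exact: continuous_horner.
have iqc : mu.-integrable `[a, b] (EFin \o horner q^`()).
  exact/continuous_compact_integrable/cq/segment_compact.
have iq : mu.-integrable `]a, b[ (EFin \o horner q^`()).
  by apply: integrableS iqc.
have ih : mu.-integrable `]a, b[ (EFin \o h).
  apply: eq_integrable ig => // s; rewrite inE/= => sab.
  by rewrite /= hg.
split => //.
have -> : q.[b] - q.[a] = \int[mu]_(s in `]a, b[) q^`().[s].
  have I : mu.-integrable `]a, b] (EFin \o horner q^`()).
    by apply: integrableS iqc => //; exact: subset_itv_oc_cc.
  rewrite Rintegral_itv_bndo_bndc// Rintegral_itv_obnd_cbnd//.
  rewrite /Rintegral (@continuous_FTC2 _ _ (horner q))//.
    split.
    - by move=> x _; exact: derivable_horner.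
    - by apply: cvg_at_right_filter; exact: continuous_horner.
    - by apply: cvg_at_left_filter; exact: continuous_horner.
  by move=> s _; rewrite derivE.
apply: le_Rintegral => // s sab.
by rewrite hg ?gq.
Qed.

Lemma derive1_horner_oo w p a b : {in `]a, b[, w =1 horner p} ->
  {in `]a, b[, w^`()%classic =1 horner p^`()}.
Proof.
move=> wp s sab; rewrite derivE !derive1E; apply: near_eq_derive.
by near do apply: wp; exact: near_in_itvoo.
Unshelve. all: by end_near. Qed.

End IntegralBounds.

(** * Monotonicity and convexity of the kernel *)

Section Kernel.
Local Open Scope classical_set_scope.
Local Open Scope ring_scope.
Context {R : realType}.
Variables (alpha x : R).
Hypothesis alpha_gt0 : 0 < alpha.
Implicit Types a b s : R.

Definition kern s := (x - s) `^ (- alpha).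

Definition kern_slope s := alpha * (x - s) `^ (- alpha - 1).

Lemma kern_slope_ge0 s : 0 <= kern_slope s.
Proof. by rewrite mulr_ge0// ?powR_ge0// ltW. Qed.

Lemma is_derive_kern s : s < x -> is_derive s 1 kern (kern_slope s).
Proof.
move=> sx; have xs : 0 < x - s by rewrite subr_gt0.
have D1 := @is_derive1_powR R (- alpha) _ xs.
have D2 : is_derive s 1 (fun s => x - s) (-1 : R).
  by have := is_deriveB (is_derive_cst x s 1) (is_derive_id s 1); rewrite sub0r.
rewrite (_ : kern_slope s = - alpha * (x - s) `^ (- alpha - 1) * -1).
  exact: (@is_derive1_comp _ (fun y : R => y `^ (- alpha)) (fun s => x - s) _ _ _ D1 D2).
by rewrite /kern_slope; ring.
Qed.

Lemma continuous_kern a b : b < x -> {within `[a, b]%classic, continuous kern}.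
Proof.
move=> bx; apply: continuous_in_subspaceT => s; rewrite inE/= in_itv/= => /andP[_ sb].
have sx : s < x by exact: le_lt_trans bx.
apply: differentiable_continuous; apply/derivable1_diffP.
by have [? _] := is_derive_kern _ sx.
Qed.

Lemma kern_slope_le a b : a <= b -> b < x -> kern_slope a <= kern_slope b.
Proof.
move=> ab bx; rewrite ler_pM2l//.
have -> : - alpha - 1 = - (alpha + 1) by ring.
rewrite !powRN lef_pV2 ?posrE ?powR_gt0 ?subr_gt0 ?(le_lt_trans ab)//.
have ax := le_lt_trans ab bx.
by apply: ge0_ler_powR; rewrite ?nnegrE ?subr_ge0 ?lerD2l ?lerN2 ?addr_ge0// ltW.
Qed.

Lemma kern_le a b : a <= b -> b < x -> kern a <= kern b.
Proof.
move=> ab bx; rewrite /kern !powRN lef_pV2 ?posrE ?powR_gt0 ?subr_gt0 ?(le_lt_trans ab)//.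
have ax := le_lt_trans ab bx.
by apply: ge0_ler_powR; rewrite ?nnegrE ?subr_ge0 ?lerD2l ?lerN2// ltW.
Qed.

Lemma is_derive_kern_sub_linear k s : s < x ->
  is_derive s 1 (fun s => kern s - k * s) (kern_slope s - k).
Proof.
move=> sx; have D := is_derive_kern _ sx.
have E := is_deriveZ k (is_derive_id s 1).
by have := is_deriveB D E; rewrite [k *: _]mulr1.
Qed.

(** By convexity, the slope of the kernel to the right of [b] is at least its slope at [b]. *)
Lemma kern_sub_tangent_nondecreasing b s1 s2 : b <= s1 -> s1 <= s2 -> s2 < x ->
  kern s1 - kern_slope b * s1 <= kern s2 - kern_slope b * s2.
Proof.
move=> bs1 s12 s2x.
have D s : s <= s2 -> is_derive s 1 (fun s => kern s - kern_slope b * s)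
    (kern_slope s - kern_slope b).
  by move=> ss2; apply: is_derive_kern_sub_linear; exact: le_lt_trans s2x.
apply: (@ger0_derive1_ndecr _ (fun s => kern s - kern_slope b * s) s1 s2) => //.
- by move=> s; rewrite in_itv/= => /andP[_ /ltW /D[]].
- move=> s; rewrite in_itv/= => /andP[s1s /ltW ss2].
  have [_] := D _ ss2; rewrite derive1E => ->; rewrite subr_ge0.
  by rewrite kern_slope_le ?(le_lt_trans ss2)// (le_trans bs1)// ltW.
- apply: continuous_in_subspaceT => s; rewrite inE/= in_itv/= => /andP[_ /D[Ds _]].
  by apply: differentiable_continuous; apply/derivable1_diffP.
Qed.

Lemma kern_sub_tangent_nonincreasing b s1 s2 : b < x -> s1 <= s2 -> s2 <= b ->
  kern s2 - kern_slope b * s2 <= kern s1 - kern_slope b * s1.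
Proof.
move=> bx s12 s2b.
have D s : s <= s2 -> is_derive s 1 (fun s => kern s - kern_slope b * s)
    (kern_slope s - kern_slope b).
  move=> ss2; apply: is_derive_kern_sub_linear.
  exact: le_lt_trans (le_trans ss2 s2b) bx.
apply: (@ler0_derive1_nincr _ (fun s => kern s - kern_slope b * s) s1 s2) => //.
- by move=> s; rewrite in_itv/= => /andP[_ /ltW /D[]].
- move=> s; rewrite in_itv/= => /andP[s1s /ltW ss2].
  have [_] := D _ ss2; rewrite derive1E => ->; rewrite subr_le0.
  by rewrite kern_slope_le// (le_trans ss2).
- apply: continuous_in_subspaceT => s; rewrite inE/= in_itv/= => /andP[_ /D[Ds _]].
  by apply: differentiable_continuous; apply/derivable1_diffP.
Qed.

End Kernel.

(** * A nodal basis function on each cell of its support *)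

Section NodalPieces.
Local Open Scope classical_set_scope.
Local Open Scope ring_scope.
Context {R : realType}.
Variables (alpha x : R).
Hypothesis alpha_gt0 : 0 < alpha.
Implicit Types (a b c d e s u v : R) (w : R -> R) (p : {poly R}).

(* The Lagrange basis polynomial of the node [c] among [c], [u], [v]. *)
Definition nodalp c u v : {poly R} :=
  ((c - u) * (c - v))^-1 *: (('X - u%:P) * ('X - v%:P)).

(** The antiderivative of [nodalp c u v] vanishing at 0; its differences are the integrals of the
    basis polynomial. *)
Definition nodalp_prim c u v : {poly R} :=
  ((c - u) * (c - v))^-1 *:
    (3^-1 *: 'X^3 - ((u + v) / 2) *: 'X^2 + (u * v) *: 'X).

Lemma nodalpE c u v s :
  (nodalp c u v).[s] = (s - u) * (s - v) / ((c - u) * (c - v)).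
Proof. by rewrite /nodalp hornerZ hornerM !hornerXsubC mulrC. Qed.

Lemma nodalp_root1 c u v : (nodalp c u v).[u] = 0.
Proof. by rewrite nodalpE subrr !mul0r. Qed.

Lemma nodalp_root2 c u v : (nodalp c u v).[v] = 0.
Proof. by rewrite nodalpE subrr mulr0 mul0r. Qed.

Lemma nodalp_node c u v : c != u -> c != v -> (nodalp c u v).[c] = 1.
Proof. by move=> cu cv; rewrite nodalpE divff// mulf_neq0// subr_eq0. Qed.

Lemma deriv_nodalpE c u v s :
  (nodalp c u v)^`().[s] = (s + s - u - v) / ((c - u) * (c - v)).
Proof.
rewrite /nodalp derivZ derivM !derivXsubC mul1r mulr1.
by rewrite hornerZ hornerD !hornerXsubC mulrC; congr (_ * _); ring.
Qed.

Lemma deriv_nodalp_primE c u v s :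
  (nodalp_prim c u v)^`().[s] = (nodalp c u v).[s].
Proof.
rewrite nodalpE /nodalp_prim derivZ hornerZ mulrC; congr (_ * _).
rewrite derivD derivB !derivZ !derivXn derivX.
rewrite !(hornerD, hornerN, hornerZ, hornerMn, hornerXn, hornerC).
by field.
Qed.

Definition caputo_integrand w s := kern alpha x s * w^`()%classic s.

(** The kernel is replaced by the affine function K + k s, which by assumption can only increase its
    product with p', where p is the basis polynomial. With P' = p, that product is the derivative of
    (K + k s) p - k P, the polynomial [q] below. *)
Lemma nodal_piece_le w a b c u v K k : a <= b -> b < x ->
  {in `]a, b[, w =1 horner (nodalp c u v)} ->
  {in `]a, b[, forall s, (kern alpha x s - k * s - K) * (nodalp c u v)^`().[s] <= 0} ->
  Rintegral_itv_le (caputo_integrand w) a b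
    ((K + k * b) * (nodalp c u v).[b] - (K + k * a) * (nodalp c u v).[a]
     - k * ((nodalp_prim c u v).[b] - (nodalp_prim c u v).[a])).
Proof.
move=> ab bx wp le0.
pose q := (K%:P + k%:P * 'X) * nodalp c u v - k%:P * nodalp_prim c u v.
have q' s : q^`().[s] = (K + k * s) * (nodalp c u v)^`().[s].
  rewrite /q !(derivB, derivM, derivD, derivC, derivX).
  rewrite !(hornerD, hornerN, hornerM, hornerC, hornerX) deriv_nodalp_primE.
  by ring.
have -> : (K + k * b) * (nodalp c u v).[b] - (K + k * a) * (nodalp c u v).[a]
    - k * ((nodalp_prim c u v).[b] - (nodalp_prim c u v).[a]) = q.[b] - q.[a].
  by rewrite /q !(hornerD, hornerN, hornerM, hornerC, hornerX); ring.
apply: (@Rintegral_itv_le_poly _ _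
  (fun s => kern alpha x s * (nodalp c u v)^`().[s])) => //.
- have ck := continuous_kern alpha _ a _ bx.
  move=> s; apply: continuousM; first exact: ck.
  by apply: continuous_subspaceT; exact: continuous_horner.
- by move=> s sab; rewrite /caputo_integrand (derive1_horner_oo _ _ _ _ wp).
- move=> s sab; rewrite q'.
  by have := le0 s sab; lra.
Qed.

(** Here p falls from 1 to 0 and the kernel is at least its value at [c], so that constant is an
    admissible replacement (k = 0). *)
Lemma nodal_falling_piece_le w c d e : c < d -> d < e -> d < x ->
  {in `]c, d[, w =1 horner (nodalp c d e)} ->
  Rintegral_itv_le (caputo_integrand w) c d (- kern alpha x c).
Proof.
move=> cd de dx wp; have ce := lt_trans cd de.
have := @nodal_piece_le w c d c d e (kern alpha x c) 0 (ltW cd) dx wp.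
rewrite nodalp_root1 nodalp_node ?lt_eqF//.
rewrite !(mul0r, mulr0, mulr1, addr0, add0r, subr0); apply.
move=> s; rewrite in_itv/= => /andP[cs sd].
rewrite mul0r subr0 deriv_nodalpE mulr_ge0_le0//.
  by rewrite subr_ge0 kern_le// ?ltW// (lt_trans sd).
rewrite pmulr_lle0; last by rewrite invr_gt0 nmulr_rgt0 subr_lt0.
by lra.
Qed.

(** The vertex (b + d) / 2 of p is at or beyond [c] because the steps do not decrease, so p rises
    from 0 to 1 and any affine majorant of the kernel is admissible. The one used meets the kernel
    at [c]. *)
Lemma nodal_rising_piece_le w b c d k : b < c -> c - b <= d - c -> c < x ->
  {in `]b, c[, w =1 horner (nodalp c b d)} ->
  {in `]b, c[, forall s, kern alpha x s - k * s <= kern alpha x c - k * c} ->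
  Rintegral_itv_le (caputo_integrand w) b c
    (kern alpha x c - k * ((nodalp_prim c b d).[c] - (nodalp_prim c b d).[b])).
Proof.
move=> bc bcd cx wp kle; have cd : c < d by lra.
have := @nodal_piece_le w b c c b d (kern alpha x c - k * c) k (ltW bc) cx wp.
rewrite nodalp_root1 nodalp_node ?(gt_eqF bc) ?(lt_eqF cd)//.
rewrite subrK mulr1 mulr0 subr0; apply.
move=> s sbc; have := kle s sbc; move: sbc; rewrite in_itv/= => /andP[bs sc] ks.
rewrite deriv_nodalpE mulr_le0_ge0 ?subr_le0//.
by rewrite mulr_le0// ?invr_le0 ?pmulr_rle0; lra.
Qed.

(** Here p vanishes at both ends and p' changes sign at the midpoint [m]. The line through the
    kernel at [m] with the slope of the kernel at [b] lies below the kernel before [m] and above it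
    after, so the product keeps one sign. *)
Lemma nodal_left_tail_piece_le w a b c : a < b -> b < c -> b < x ->
  {in `]a, b[, w =1 horner (nodalp c a b)} ->
  Rintegral_itv_le (caputo_integrand w) a b
    (- kern_slope alpha x b * ((nodalp_prim c a b).[b] - (nodalp_prim c a b).[a])).
Proof.
move=> ab bc bx wp.
rewrite mulNr; set k := kern_slope alpha x b; pose m := (a + b) / 2.
have := @nodal_piece_le w a b c a b (kern alpha x m - k * m) k (ltW ab) bx wp.
rewrite nodalp_root1 nodalp_root2 !mulr0 subrr add0r; apply.
move=> s; rewrite in_itv/= => /andP[as' sb].
rewrite deriv_nodalpE mulrA pmulr_lle0; last first.
  by rewrite invr_gt0 mulr_gt0//; lra.
have [sm|ms] := leP s m.
- rewrite mulr_ge0_le0//; last by rewrite /m in sm; lra.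
  rewrite subr_ge0; apply: kern_sub_tangent_nonincreasing => //.
  by rewrite /m; lra.
- rewrite mulr_le0_ge0//; last by rewrite /m in ms; lra.
  rewrite subr_le0; apply: kern_sub_tangent_nonincreasing => //; exact: ltW.
Qed.

Lemma nodal_prim_ge0 a b c d : a < b -> b < c -> b - a <= c - b -> c < d ->
  0 <= ((nodalp_prim c a b).[b] - (nodalp_prim c a b).[a]) +
       ((nodalp_prim c b d).[c] - (nodalp_prim c b d).[b]).
Proof.
move=> ab bc abc cd.
pose r := b - a; pose p := c - b; pose q := d - c.
have r0 : 0 < r by rewrite subr_gt0.
have p0 : 0 < p by rewrite subr_gt0.
have q0 : 0 < q by rewrite subr_gt0.
(* The two integrals are -r^3 / (6 p (r + p)) and p/2 + p^2 / (6 q). The share p/6 of p/2 absorbs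
   the negative one, since r <= p. *)
have -> : ((nodalp_prim c a b).[b] - (nodalp_prim c a b).[a]) +
       ((nodalp_prim c b d).[c] - (nodalp_prim c b d).[b]) =
  (6 * ((r + p) * p))^-1 * (p ^+ 2 * (r + p) - r ^+ 3) +
  p ^+ 2 / (6 * q) + p / 3.
  rewrite /nodalp_prim !(hornerD, hornerN, hornerZ, hornerXn, hornerX) /r /p /q.
  field.
  by rewrite ?subr_eq0 ?(gt_eqF ab) ?(gt_eqF bc) ?(lt_eqF cd) ?(gt_eqF cd) //; lra.
apply: addr_ge0; last by rewrite divr_ge0 ?ltW.
apply: addr_ge0; last by rewrite divr_ge0 ?exprn_ge0 ?mulr_ge0 ?ltW.
apply: mulr_ge0.
  by rewrite invr_ge0 mulr_ge0 // mulr_ge0 // ltW // addr_gt0.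
have : r ^+ 3 <= p ^+ 3 by rewrite lerXn2r ?nnegrE// ltW.
have : 0 <= p ^+ 2 * r by rewrite mulr_ge0 ?exprn_ge0 // ltW.
by lra.
Qed.

(** This is the case without a left tail. Monotonicity of the kernel suffices: with k = 0 the bounds
    on the two cells cancel. *)
Lemma nodal_first_le0 w b c d e : b < c -> c - b <= d - c -> d < e -> d < x ->
  {in `]b, c[, w =1 horner (nodalp c b d)} ->
  {in `]c, d[, w =1 horner (nodalp c d e)} ->
  Rintegral_itv_le (caputo_integrand w) b d 0.
Proof.
move=> bc bcd de dx w1 w2; have cd : c < d by lra.
have cx := lt_trans cd dx.
have kle : {in `]b, c[, forall s, kern alpha x s - 0 * s <= kern alpha x c - 0 * c}.
  move=> s; rewrite in_itv/= => /andP[_ sc].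
  by rewrite !mul0r !subr0 kern_le// ltW.
have := @nodal_rising_piece_le w b c d 0 bc bcd cx w1 kle.
rewrite mul0r subr0 => I1.
have I2 := @nodal_falling_piece_le w c d e cd de dx w2.
rewrite -(subrr (kern alpha x c)).
exact: (Rintegral_itv_le_split _ _ _ _ _ _ (ltW bc) (ltW cd) I1 I2).
Qed.

(* The kernel minus its tangent at [b] is monotone on either side of [b]; this
   bounds the integral by a nonpositive multiple of the integral of [w] over the
   first two cells. *)
Lemma nodal_interior_le0 w a b c d e :
  a < b -> b - a <= c - b -> c - b <= d - c -> d < e -> d < x ->
  {in `]a, b[, w =1 horner (nodalp c a b)} ->
  {in `]b, c[, w =1 horner (nodalp c b d)} ->
  {in `]c, d[, w =1 horner (nodalp c d e)} ->
  Rintegral_itv_le (caputo_integrand w) a d 0.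
Proof.
move=> ab abc bcd de dx w0 w1 w2.
have bc : b < c by lra.
have cd : c < d by lra.
have cx := lt_trans cd dx; have bx := lt_trans bc cx.
have I0 := @nodal_left_tail_piece_le w a b c ab bc bx w0.
have I1 := @nodal_rising_piece_le w b c d (kern_slope alpha x b) bc bcd cx w1.
have I2 := @nodal_falling_piece_le w c d e cd de dx w2.
have kle : {in `]b, c[, forall s, kern alpha x s - kern_slope alpha x b * s <=
    kern alpha x c - kern_slope alpha x b * c}.
  move=> s; rewrite in_itv/= => /andP[bs sc].
  by apply: kern_sub_tangent_nondecreasing => //; exact: ltW.
have [iI lI] := Rintegral_itv_le_split _ _ _ _ _ _ (ltW ab) (ltW (lt_trans bc cd))
  I0 (Rintegral_itv_le_split _ _ _ _ _ _ (ltW bc) (ltW cd) (I1 kle) I2).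
split => //; apply: le_trans lI _.
have P := nodal_prim_ge0 _ _ _ _ ab bc abc cd.
have := mulr_ge0 (kern_slope_ge0 _ x alpha_gt0 b) P.
lra.
Qed.

End NodalPieces.

(** * Cells, stencils and the interpolants of basis functions *)

Section Mesh.
Local Open Scope classical_set_scope.
Local Open Scope ring_scope.
Context {R : realType}.
Variables (t : nat -> R) (M : nat).
Hypothesis t_step : forall j : nat, (1 <= j <= M)%N -> t j.-1 < t j.
Implicit Types (s : R) (U : nat -> R) (i j k l m n : nat).

Lemma mesh_lt i j : (i < j <= M)%N -> t i < t j.
Proof.
elim: j => // j IH /andP[ij jM]; have tj := t_step j.+1 jM.
move: ij; rewrite ltnS leq_eqVlt => /predU1P[->//|ij].
by apply: lt_trans tj; apply: IH; rewrite ij ltnW.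
Qed.

Lemma mesh_le i j : (i <= j <= M)%N -> t i <= t j.
Proof.
move=> /andP[]; rewrite leq_eqVlt => /predU1P[->//|ij jM].
by rewrite ltW// mesh_lt ?ij.
Qed.

Lemma mesh_neq i j : (i < j <= M)%N -> (t i != t j) * (t j != t i).
Proof. by move=> /mesh_lt ij; rewrite lt_eqF ?gt_eqF. Qed.

Lemma cell_le l m s : (0 < l)%N -> s <= t l -> (cell t m s <= l)%N.
Proof.
case: l => // l _ sl; rewrite /cell ltnS leqNgt; apply/negP => lf.
have lm : (l < m.-1)%N.
  by rewrite (leq_trans lf)// -[X in (_ <= X)%N](size_iota 1) find_size.
by have := before_find 0%N lf; rewrite nth_iota// add1n sl.
Qed.

Lemma cell_le_last m s : (0 < m)%N -> (cell t m s <= m)%N.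
Proof.
case: m => // m _; rewrite /cell ltnS -[X in (_ <= X)%N](size_iota 1).
exact: find_size.
Qed.

Lemma cell_gt l m s : (l < m <= M)%N -> t l < s -> (l < cell t m s)%N.
Proof.
move=> /andP[lm mM] ls; rewrite /cell ltnS leqNgt; apply/negP => fl.
have hf : has (fun j => s <= t j) (iota 1 m.-1) by rewrite has_find size_iota; lia.
have := nth_find 0%N hf; rewrite nth_iota; last by lia.
rewrite leNgt => /negP; apply; apply: le_lt_trans ls.
by apply: mesh_le; lia.
Qed.

Lemma cell_eq n m s : (n < m <= M)%N -> t n < s -> s <= t n.+1 -> cell t m s = n.+1.
Proof.
by move=> nm ns sn; apply/anti_leq/andP; split; [exact: cell_le|exact: cell_gt].
Qed.

Lemma lagrange_interp2 U s :
  lagrange_interp t U [:: 0; 1]%N s =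
  U 0 * ((s - t 1) / (t 0 - t 1)) + U 1 * ((s - t 0) / (t 1 - t 0)).
Proof. by rewrite /lagrange_interp !(big_cons, big_nil)/= !mulr1 addr0. Qed.

Lemma lagrange_interp3 n U s :
  lagrange_interp t U [:: n; n.+1; n.+2]%N s =
  U n * ((s - t n.+1) / (t n - t n.+1) * ((s - t n.+2) / (t n - t n.+2))) +
  (U n.+1 * ((s - t n) / (t n.+1 - t n) * ((s - t n.+2) / (t n.+1 - t n.+2))) +
   U n.+2 * ((s - t n) / (t n.+2 - t n) * ((s - t n.+1) / (t n.+2 - t n.+1)))).
Proof.
have E : (n.+2 == n) = false by lia.
have E' : (n == n.+2) = false by lia.
have F k : (k.+1 == k) = false by lia.
have F' k : (k == k.+1) = false by lia.
by rewrite /lagrange_interp !(big_cons, big_nil) !eqxx !(E, E', F, F')/= !mulr1 addr0.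
Qed.

Lemma lagrange_interp_nodal0 j (J : seq nat) s : j \notin J ->
  lagrange_interp t (nodal_basis R j) J s = 0.
Proof.
move=> jJ; apply: big1_seq => i /= iJ; rewrite /nodal_basis.
by case: eqVneq iJ jJ => [-> -> //|_ _ _]; rewrite mul0r.
Qed.

(** Interior cells and the last cell all use three consecutive nodes, so one three-point identity
    covers them. *)
Lemma stencil_cell m i : (1 < m)%N -> (0 < i <= m)%N ->
  exists2 n, (n.+2 <= m)%N & stencil m i = [:: n; n.+1; n.+2].
Proof.
move=> m1 /andP[i0 im]; rewrite /stencil gtn_eqF//; case: ifPn => imn.
  by case: i i0 im imn => // i _ _ imn; exists i.
by case: m m1 im imn => [|[|m]]// _ _ _; exists m.
Qed.

(** Since [cell] always returns an index in 1..m, this holds on the whole line; the derivative thus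
    vanishes at the nodes too. *)
Lemma interpolant1 m s : (0 < m <= M)%N -> interpolant t m (fun=> 1) s = 1.
Proof.
move=> /andP[m0 mM]; rewrite /interpolant.
have [m1|m1] := leqP m 1.
  have -> : m = 1%N by lia.
  have [/negPf n1 /negPf n2] := mesh_neq 0 1 (leq_trans m0 mM).
  rewrite /stencil/= lagrange_interp2; field.
  by rewrite ?subr_eq0 ?n1 ?n2.
have [|n nm ->] := stencil_cell m (cell t m s) m1.
  by rewrite cell_le_last.
have n01 := mesh_neq n n.+1; have n12 := mesh_neq n.+1 n.+2.
have n02 := mesh_neq n n.+2.
rewrite lagrange_interp3; field.
by rewrite !subr_eq0 ?n01 ?n12 ?n02//; lia.
Qed.

Lemma frac_delta1 alpha m : (0 < m <= M)%N -> frac_delta alpha t (fun=> 1) m = 0.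
Proof.
move=> mM; rewrite /frac_delta /caputo.
have -> : interpolant t m (fun=> 1) = cst 1.
  by apply/funext => s; exact: interpolant1.
rewrite (_ : (fun _ => _) = cst 0); last first.
  by apply/funext => s; rewrite derive1_cst mulr0.
by rewrite Rintegral_cst// mul0r mulr0.
Qed.

Lemma interpolant_nodal_cell m n j : (n.+1 < m <= M)%N ->
  {in `]t n, t n.+1[, interpolant t m (nodal_basis R j) =1
     lagrange_interp t (nodal_basis R j) [:: n; n.+1; n.+2]}.
Proof.
move=> /andP[nm mM] s; rewrite in_itv/= => /andP[ns sn].
rewrite /interpolant (cell_eq n) ?ltW//; last by rewrite ltnW.
by rewrite /stencil nm gtn_eqF// (leq_ltn_trans _ nm).
Qed.

(** The suffixes [left], [mid], [right] locate the node within the stencil. For a node of index at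
    most m - 3 they correspond to the last, middle and first cell of its support. *)
Lemma interpolant_nodal_left m n : (n.+1 < m <= M)%N ->
  {in `]t n, t n.+1[, interpolant t m (nodal_basis R n) =1
     horner (nodalp (t n) (t n.+1) (t n.+2))}.
Proof.
move=> nm s sn; rewrite (interpolant_nodal_cell _ _ _ nm _ sn) lagrange_interp3 nodalpE.
have E : (n.+2 == n) = false by lia.
have E' : (n.+1 == n) = false by lia.
rewrite /nodal_basis eqxx E E' !mul0r !addr0 mul1r invfM; ring.
Qed.

Lemma interpolant_nodal_mid m n : (n.+1 < m <= M)%N ->
  {in `]t n, t n.+1[, interpolant t m (nodal_basis R n.+1) =1
     horner (nodalp (t n.+1) (t n) (t n.+2))}.
Proof.
move=> nm s sn; rewrite (interpolant_nodal_cell _ _ _ nm _ sn) lagrange_interp3 nodalpE.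
have E : (n.+2 == n.+1) = false by lia.
have E' : (n == n.+1) = false by lia.
rewrite /nodal_basis eqxx E E' !mul0r addr0 add0r mul1r invfM; ring.
Qed.

Lemma interpolant_nodal_right m n : (n.+1 < m <= M)%N ->
  {in `]t n, t n.+1[, interpolant t m (nodal_basis R n.+2) =1
     horner (nodalp (t n.+2) (t n) (t n.+1))}.
Proof.
move=> nm s sn; rewrite (interpolant_nodal_cell _ _ _ nm _ sn) lagrange_interp3 nodalpE.
have E : (n.+1 == n.+2) = false by lia.
have E' : (n == n.+2) = false by lia.
rewrite /nodal_basis eqxx E E' !mul0r !add0r mul1r invfM; ring.
Qed.

(** Cells numbered up to n have stencils ending at n + 1 or earlier. Numbering starts at 1, so
    points left of [t 0] still belong to cell 1; hence n > 0. *)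
Lemma interpolant_nodal_before m n s : (n.+2 < m <= M)%N -> (0 < n)%N -> s < t n ->
  interpolant t m (nodal_basis R n.+2) s = 0.
Proof.
move=> nm n0 sn; apply: lagrange_interp_nodal0.
have cn : (cell t m s <= n)%N by apply: cell_le => //; exact: ltW.
rewrite /stencil gtn_eqF; last by lia.
case: ifPn => [_|]; last by lia.
by rewrite !inE; lia.
Qed.

(** Past t_(j+1) interior stencils start at j + 1 or later; the last one starts at m - 2, which
    exceeds j exactly when j <= m - 3. *)
Lemma interpolant_nodal_after m j s : (j.+2 < m <= M)%N -> t j.+1 < s ->
  interpolant t m (nodal_basis R j) s = 0.
Proof.
move=> jm js; apply: lagrange_interp_nodal0.
have cn : (j.+1 < cell t m s)%N by apply: cell_gt => //; lia.
rewrite /stencil gtn_eqF; last by lia.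
by case: ifPn => _; rewrite !inE; lia.
Qed.

(** * Discrete derivatives of basis functions far from the diagonal *)

Variable alpha : R.
Hypothesis alpha_gt0 : 0 < alpha.
Hypothesis t0 : t 0%N = 0.
Hypothesis t_grading : forall j : nat, (2 <= j <= M)%N -> 1 <= rho t j.

Lemma mesh_step_le n : (n.+2 <= M)%N -> t n.+1 - t n <= t n.+2 - t n.+1.
Proof.
move=> nM; have := t_grading n.+2 nM; rewrite /rho /tau/= ler_pdivlMr ?mul1r//.
by rewrite subr_gt0 mesh_lt//; lia.
Qed.

Notation integrand m j := (caputo_integrand alpha (t m) (interpolant t m (nodal_basis R j))).

Lemma caputo_integrand_itv_le0 w x (a b : R) : {in `]a, b[, w =1 cst 0} ->
  Rintegral_itv_le (caputo_integrand alpha x w) a b 0.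
Proof.
move=> w0; have E : {in `]a, b[, caputo_integrand alpha x w =1 cst 0}.
  move=> s sab; rewrite /caputo_integrand (derive1_horner_oo w 0 a b)//.
    by rewrite deriv0 horner0 mulr0.
  by move=> r rab; rewrite w0// horner0.
split; last first.
  rewrite (@eq_Rintegral _ _ _ _ _ (cst 0)) => [|s]; last by rewrite inE; exact: E.
  by rewrite Rintegral_cst// mul0r.
apply: eq_integrable (integrable0 _ _) => // s; rewrite inE => sab.
by rewrite /= E.
Qed.

Lemma nodal_integral_after m j u : (j.+2 < m <= M)%N ->
  Rintegral_itv_le (integrand m j) 0 (t j.+1) u ->
  Rintegral_itv_le (integrand m j) 0 (t m) u.
Proof.
move=> jm I; rewrite -[u]addr0.
apply: (Rintegral_itv_le_split _ _ _ _ _ _ _ _ I).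
- by rewrite -t0 mesh_le//; lia.
- by rewrite mesh_le//; lia.
- apply: caputo_integrand_itv_le0 => s; rewrite in_itv/= => /andP[js _].
  exact: interpolant_nodal_after.
Qed.

Lemma nodal_integral_le0 m j : (j.+2 < m <= M)%N ->
  Rintegral_itv_le (integrand m j) 0 (t m) 0.
Proof.
move=> jm; apply: nodal_integral_after => //.
have jx k : (k <= j.+1)%N -> t k < t m by move=> kj; rewrite mesh_lt//; lia.
have sl k : (k <= j.+1)%N -> t k < t k.+1 by move=> kj; rewrite mesh_lt//; lia.
have dl k : (k <= j)%N -> t k.+1 - t k <= t k.+2 - t k.+1.
  by move=> kj; rewrite mesh_step_le//; lia.
(* The support has one cell for j = 0, two for j = 1, and three from j = 2 on. *)
case: j jm jx sl dl => [|[|n]] jm jx sl dl.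
- have [i l] : Rintegral_itv_le (integrand m 0%N) 0 (t 1%N) (- kern alpha (t m) 0).
    rewrite -[in X in Rintegral_itv_le _ X _]t0 -[in X in kern _ _ X]t0.
    apply: (@nodal_falling_piece_le _ _ _ alpha_gt0 _ _ _ (t 2%N)); rewrite ?sl ?jx//.
    by apply: interpolant_nodal_left; lia.
  by split=> //; apply: le_trans l _; rewrite oppr_le0 powR_ge0.
- rewrite -[in X in Rintegral_itv_le _ X _]t0; apply: (@nodal_first_le0 _ _ _ alpha_gt0 _ _ (t 1%N) _ (t 3%N));
    rewrite ?sl ?jx ?dl//.
    by apply: interpolant_nodal_mid; lia.
  by apply: interpolant_nodal_left; lia.
- rewrite -[X in Rintegral_itv_le _ _ _ X]addr0.
  apply: (Rintegral_itv_le_split _ _ (t n)).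
  + by rewrite -t0 mesh_le//; lia.
  + by rewrite mesh_le//; lia.
  + apply: caputo_integrand_itv_le0 => s; rewrite in_itv/= => /andP[s0 sn].
    have [n0|n0] := posnP n; first by move: sn; rewrite n0 t0 ltNge (ltW s0).
    by apply: interpolant_nodal_before => //; lia.
  + apply: (@nodal_interior_le0 _ _ _ alpha_gt0 _ _ (t n.+1) (t n.+2) _ (t n.+4));
      rewrite ?sl ?jx ?dl//; try lia.
    * by apply: interpolant_nodal_right; lia.
    * by apply: interpolant_nodal_mid; lia.
    * by apply: interpolant_nodal_left; lia.
Qed.

(** The integrand is nonnegative, and the default value 0 of a divergent integral is harmless
    here. *)
Lemma Gamma_ge0 (z : R) : 0 <= Gamma z.
Proof. by apply: Rintegral_ge0 => s _; rewrite mulr_ge0 ?powR_ge0 ?expR_ge0. Qed.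

Lemma frac_delta_nodal_le0 m j : (j.+2 < m <= M)%N ->
  frac_delta alpha t (nodal_basis R j) m <= 0.
Proof.
move=> jm; rewrite mulr_ge0_le0 ?invr_ge0 ?Gamma_ge0//.
by have [] := nodal_integral_le0 _ _ jm.
Qed.

Lemma frac_delta_nodal0_le m : (2 < m <= M)%N ->
  frac_delta alpha t (nodal_basis R 0%N) m <=
  - ((Gamma (1 - alpha))^-1 * t m `^ (- alpha)).
Proof.
move=> m2; rewrite -mulrN ler_wpM2l ?invr_ge0 ?Gamma_ge0//.
suff [] : Rintegral_itv_le (integrand m 0%N) 0 (t m) (- t m `^ (- alpha)) by [].
apply: nodal_integral_after => //.
(* The bound is recast as the kernel at t_0 = 0, the left end of the falling cell. *)
rewrite -[in t m `^ _](subr0 (t m)) -[in t m - 0]t0.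
rewrite -[in X in Rintegral_itv_le _ X _]t0.
apply: (@nodal_falling_piece_le _ _ _ alpha_gt0 _ _ _ (t 2%N));
  rewrite ?mesh_lt//; try lia.
by apply: interpolant_nodal_left; lia.
Qed.

End Mesh.

(** * Algebra of the coefficients in the V-representation *)

Lemma big_nat_indicator (R : pzSemiRingType) (n k : nat) (f : nat -> R) :
  \sum_(0 <= j < n) f j * (j == k)%:R = (if (k < n)%N then f k else 0).
Proof.
elim: n => [|n IH]; first by rewrite big_geq.
rewrite big_nat_recr//= IH ltnS; case: ltngtP => [||<-].
- by rewrite mulr0 addr0.
- by rewrite mulr0 addr0.
- by rewrite mulr1 add0r.
Qed.

Section Coefficients.
Context {R : realType}.
Variables (beta kap : nat -> R) (m : nat).
Hypothesis beta0 : beta 0%N = 0.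
Hypothesis beta_lt1 : forall j, (1 <= j <= m)%N -> beta j < 1.

Let c j := kap j / (1 - beta j).

(** Summation by parts: the terms in U^(j-1) are reindexed. As beta_0 = 0, the convention V^0 = U^0
    agrees with c_0 = kappa_0. *)
Lemma sum_Vseq (U : nat -> R) :
  \sum_(0 <= j < m.+1) kap j * Vseq beta U j =
  \sum_(0 <= j < m.+1) c j * U j -
  \sum_(0 <= j < m) (beta j.+1 * c j.+1) * U j.
Proof.
rewrite !big_nat_recl// -addrA -sumrB; congr (_ + _).
  by rewrite /c /Vseq/= beta0 subr0 divr1.
by apply: eq_bigr => j _; rewrite /c /Vseq/=; ring.
Qed.

Lemma sum_Vseq_nodal k : (k < m)%N ->
  \sum_(0 <= j < m.+1) kap j * Vseq beta (nodal_basis R k) j =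
  c k - beta k.+1 * c k.+1.
Proof.
by move=> km; rewrite sum_Vseq /nodal_basis !big_nat_indicator km ltnS ltnW.
Qed.

Lemma sum_Vseq_nodal_last :
  \sum_(0 <= j < m.+1) kap j * Vseq beta (nodal_basis R m) j = c m.
Proof. by rewrite sum_Vseq /nodal_basis !big_nat_indicator ltnSn ltnn subr0. Qed.

Lemma sum_Vseq1 :
  \sum_(0 <= j < m.+1) kap j * Vseq beta (fun=> 1) j = \sum_(0 <= j < m.+1) kap j.
Proof.
apply: eq_big_nat => j /andP[_ jm]; rewrite /Vseq.
case: eqVneq => [_|j0]; first by rewrite mulr1.
by rewrite mulr1 divff ?mulr1// subr_eq0 gt_eqF// beta_lt1//; lia.
Qed.

End Coefficients.

(** * Signs, row sums and the lower bound *)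

Theorem lemma2p3 (R : realType) (alpha T : R)
    (halpha : 0 < alpha < 1) (hT : 0 < T) :
  exists2 C : R, 0 < C &
  forall (M : nat) (t beta : nat -> R) (kappa : nat -> nat -> R),
    (0 < M)%N ->
    t 0%N = 0 -> t M = T ->
    (forall j : nat, (1 <= j <= M)%N -> t j.-1 < t j) ->
    (forall j : nat, (2 <= j < M)%N -> rho t j.+1 <= rho t j) ->
    (forall j : nat, (2 <= j <= M)%N -> 1 <= rho t j) ->
    beta 0%N = 0 ->
    (forall j : nat, (1 <= j <= M)%N -> 0 <= beta j < 1) ->
    (forall (U : nat -> R) (m : nat), (1 <= m <= M)%N ->
       frac_delta alpha t U m =
         \sum_(0 <= j < m.+1) kappa m j * Vseq beta U j) ->
    (forall m : nat, (1 <= m <= M)%N ->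
       frac_delta alpha t (nodal_basis R m.-1) m
         + beta m * frac_delta alpha t (nodal_basis R m) m < 0) ->
    (forall m : nat, (2 <= m <= M)%N ->
       frac_delta alpha t (nodal_basis R m.-2) m
         + beta m.-1 * (frac_delta alpha t (nodal_basis R m.-1) m
             + beta m * frac_delta alpha t (nodal_basis R m) m) <= 0) ->
    [/\ forall m : nat, (1 <= m <= M)%N ->
          0 < kappa m m /\ \sum_(0 <= j < m.+1) kappa m j = 0,
        forall j m : nat, (j < m <= M)%N -> kappa m j <= 0
      & forall m : nat, (3 <= m <= M)%N ->
          C * (t m) `^ (- alpha) <= - kappa m 0%N].
Proof.
have /andP[alpha_gt0 _] := halpha.
(* Should the integral defining Gamma take the junk value 0, then frac_delta
   vanishes identically, against the first condition on the mesh with m = 1. *)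
exists (if Gamma (1 - alpha) == 0 then 1 else (Gamma (1 - alpha))^-1).
  by case: eqVneq => // G0; rewrite invr_gt0 lt_neqAle eq_sym G0 Gamma_ge0.
move=> M t beta kappa M0 t0 tM tstep _ tgrad beta0 betaI rep H1 H2.
have GE : Gamma (1 - alpha) == 0 = false.
  apply/eqP => G0; have := H1 1%N M0.
  have F0 U m : frac_delta alpha t U m = 0.
    by rewrite /frac_delta /caputo G0 invr0 mul0r.
  by rewrite !F0 mulr0 addr0 ltxx.
have b1 m : (m <= M)%N -> forall j, (1 <= j <= m)%N -> beta j < 1.
  by move=> mM j jm; have /andP[] : 0 <= beta j < 1 by apply: betaI; lia.
have b_gt0 j : (j <= M)%N -> 0 < 1 - beta j.
  case: j => [|j] jM; first by rewrite beta0 subr0.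
  by rewrite subr_gt0 (b1 M).
have b_ge0 j : (j <= M)%N -> 0 <= beta j.
  case: j => [|j] jM; first by rewrite beta0.
  by have /andP[] := betaI j.+1 jM.
have sum0 m : (1 <= m <= M)%N -> \sum_(0 <= j < m.+1) kappa m j = 0.
  move=> mM; have /andP[_ mM'] := mM.
  rewrite -(sum_Vseq1 _ _ _ (b1 m mM')) -rep//.
  by rewrite (frac_delta1 _ _ tstep).
pose c m j := kappa m j / (1 - beta j).
have aE m k : (k < m <= M)%N ->
    frac_delta alpha t (nodal_basis R k) m = c m k - beta k.+1 * c m k.+1.
  by move=> /andP[km mM]; rewrite rep ?sum_Vseq_nodal//; lia.
have aEm m : (1 <= m <= M)%N -> frac_delta alpha t (nodal_basis R m) m = c m m.
  by move=> mM; rewrite rep ?sum_Vseq_nodal_last.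
have c_last m : (m.+1 <= M)%N -> c m.+1 m < 0.
  by move=> mM; have := H1 m.+1 mM; rewrite aE ?ltnSn// aEm//= subrK.
have c_le0 m j : (j < m <= M)%N -> c m j <= 0.
  move=> /andP[jm mM].
  (* Descending induction on j, run on the distance m - (j + 1), which is 0 at j = m - 1. *)
  elim: {j}(m - j.+1)%N {-2}j jm (erefl (m - j.+1)%N) => [|n IH] j jm mj.
    have -> : m = j.+1 by lia.
    by rewrite ltW// c_last//; lia.
  have IHj : c m j.+1 <= 0 by apply: IH; lia.
  have [jm2|jm2] := ltnP j.+2 m.
    have : frac_delta alpha t (nodal_basis R j) m <= 0.
      by apply: (frac_delta_nodal_le0 t M) => //; rewrite jm2.
    rewrite aE ?jm// subr_le0 => /le_trans; apply.
    by rewrite mulr_ge0_le0// b_ge0//; lia.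
  (* For j = m - 2, writing the nodal values through [c] makes the left side of the second
     assumption collapse to c_(m-2). *)
  have mE : m = j.+2 by lia.
  have := H2 m; rewrite mE /= => /(_ _).
  rewrite aEm ?aE; try lia.
  by rewrite !subrK -mE; apply; lia.
have kE m j : (j <= M)%N -> kappa m j = (1 - beta j) * c m j.
  by move=> jM; rewrite mulrC divfK// gt_eqF// b_gt0.
have k_le0 j m : (j < m <= M)%N -> kappa m j <= 0.
  move=> jm; rewrite kE; last by lia.
  by rewrite mulr_ge0_le0 ?c_le0// ltW// b_gt0//; lia.
split=> //.
- case=> // m mM; split; last exact: sum0.
  (* The last two terms are split off: the diagonal one is minus the sum of the others, of which the
     one next to the diagonal is strictly negative. *)
  have := sum0 m.+1 mM; rewrite big_nat_recr//= big_nat_recr//= => /eqP.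
  rewrite addrC addr_eq0 => /eqP ->; rewrite oppr_gt0.
  rewrite ltr_wnDl//.
    by rewrite big_nat sumr_le0// => j /andP[_ jm]; apply: k_le0; lia.
  rewrite kE; last by lia.
  by rewrite pmulr_rlt0 ?c_last ?b_gt0//; lia.
- move=> m m3; rewrite GE -lerN2 opprK.
  (* Since beta_0 = 0, kappa_(m,0) = c_0 = a_0 + beta_1 c_1 <= a_0. *)
  apply: le_trans (_ : _ <= frac_delta alpha t (nodal_basis R 0%N) m) _; last first.
    exact: frac_delta_nodal0_le m3.
  rewrite aE; last by lia.
  rewrite kE// beta0 subr0 mul1r lerBrDl.
  rewrite gerDr mulr_ge0_le0 ?b_ge0 ?c_le0//; lia.
Qed.
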